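(* Let $r,n\ge 1$ be integers, $A=[r]=\{1,\dots,r\}$, and $s\in\{1,\dots,r\}$. Let $f:A^n\to[0,1]$ be an $s$-compressed fractional family with $|f|\le s^n$, and let $h=b^{(n,s)}_{k,\alpha}$ be a fractional Hamming ball on $A^n$ with $|h|=|f|$. Then $|\Delta f|\ge|\Delta h|$.
   Context: A fractional family on $A^n$ is any function $f:A^n\to[0,1]$; its weight is $|f|=\sum_{w\in A^n}f(w)$. Its deletion shadow is the fractional family $\Delta f$ on $A^{n-1}$ given by $(\Delta f)(x_1,\dots,x_{n-1})=\max_{y\in A,\ i\in[n]} f(x_1,\dots,x_{i-1},y,x_i,\dots,x_{n-1})$ (the maximum over all ways of inserting one letter $y$ at position $i$). For integers $k\ge 0$ and $\alpha\in[0,1]$, the fractional Hamming ball $b^{(n,s)}_{k,\alpha}:A^n\to[0,1]$ takes value $1$ on words of $[s]^n$ containing the symbol $s$ at most $k$ times, value $\alpha$ on words of $[s]^n$ containing the symbol $s$ exactly $k+1$ times, and $0$ on all other words of $A^n$. (For every weight in $[0,s^n]$ there is such a ball of that weight, and the ball as a function is determined by its weight, since e.g. $b_{k-1,1}=b_{k,0}$.) For $\ell\in A$, a fractional family $f$ on $A^n$ is $\ell$-compressed if for all $x_1,\dots,x_n,y\in A$ and $i\in[n]$ with $y<x_i$ and $\ell\le x_i$, $f(x_1,\dots,x_n)>0$ implies $f(x_1,\dots,x_{i-1},y,x_{i+1},\dots,x_n)=1$. *)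

(* Defs.v *)
From HB Require Import structures.
From mathcomp Require Import all_boot all_order all_algebra.
From mathcomp Require Import reals.
From mathcomp Require Import zify.
Set Implicit Arguments. Unset Strict Implicit. Unset Printing Implicit Defensive.
Import Order.TTheory GRing.Theory Num.Theory.
Local Open Scope ring_scope.

(* Alphabet A = [r] is represented by 'I_r; the letter a : 'I_r stands for
   the symbol sym a = val a + 1 in {1,...,r}. Order on letters = order on symbols. *)
Definition sym (r : nat) (a : 'I_r) : nat := (val a).+1.

Definition frac_family (R : realType) (r n : nat) (f : n.-tuple 'I_r -> R) : Prop :=
  forall w, 0 <= f w <= 1.

Definition weight (R : realType) (r n : nat) (f : n.-tuple 'I_r -> R) : R :=
  \sum_(w : n.-tuple 'I_r) f w.

Lemma ins_size (r m : nat) (i : 'I_m.+1) (y : 'I_r) (x : m.-tuple 'I_r) :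
  size (take i x ++ y :: drop i x) == m.+1.
Proof.
rewrite size_cat /= size_take size_drop size_tuple.
have := ltn_ord i; rewrite ltnS => him.
case: ltnP => h; apply/eqP; lia.
Qed.

Definition ins (r m : nat) (i : 'I_m.+1) (y : 'I_r) (x : m.-tuple 'I_r)
  : m.+1.-tuple 'I_r := Tuple (ins_size i y x).

(* deletion shadow: (Delta f)(x) = max over positions i and letters y of
   f(x with y inserted at position i).  Values of f are >= 0 and the range is
   nonempty when r >= 1, so the fold with 0 computes this maximum. *)
Definition shadow (R : realType) (r m : nat) (f : m.+1.-tuple 'I_r -> R)
  : m.-tuple 'I_r -> R :=
  fun x => \big[Num.max/0]_(i < m.+1) \big[Num.max/0]_(y : 'I_r) f (ins i y x).

Definition ball (R : realType) (r n s k : nat) (alpha : R) : n.-tuple 'I_r -> R :=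
  fun w =>
    if all (fun a => sym a <= s)%N w then
      let c := count (fun a => sym a == s) w in
      if (c <= k)%N then 1 else if c == k.+1 then alpha else 0
    else 0.

Definition replace (r n : nat) (w : n.-tuple 'I_r) (i : 'I_n) (y : 'I_r)
  : n.-tuple 'I_r := [tuple (if j == i then y else tnth w j) | j < n].

Definition compressed (R : realType) (r n l : nat) (f : n.-tuple 'I_r -> R) : Prop :=
  forall (w : n.-tuple 'I_r) (i : 'I_n) (y : 'I_r),
    (sym y < sym (tnth w i))%N -> (l <= sym (tnth w i))%N ->
    0 < f w -> f (replace w i y) = 1.

(* Main.v *)
Require Import Defs.
From HB Require Import structures.
From mathcomp Require Import all_boot all_order all_algebra.
From mathcomp Require Import reals.
From mathcomp Require Import ring lra.
Set Implicit Arguments. Unset Strict Implicit. Unset Printing Implicit Defensive.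
Import Order.TTheory GRing.Theory Num.Theory.
Local Open Scope ring_scope.

(** Put [q = s - 1] and let [T_n phi] be the weight on [s]^n of the family
    [w |-> phi (number of s in w)]. Balls are the case where [phi] is a
    threshold function, and for [q > 0] the shadow of the ball of [phi] on A^n
    is the ball of [phi] on A^(n-1). The points [(T_n phi, T_(n-1) phi)] of
    balls lie on a concave curve, and it suffices to show by induction on [n]
    that [(|f|, |Delta f|)] lies above that curve. Let [|f| = T_n phi]
    ([phi = 1] if [|f| > s^n]), [a = T_(n-1) phi] and [c = T_(n-1) (phi o succ)],
    so [|f| >= q a + c]; let [f_y x = f (y x)] be the slices of [f]. If some [|f_y| >= a], we are done,
    as the shadow dominates each slice. Otherwise the vector of the [|f_y|] is
    majorized by [(a, ..., a, c)] with [q] entries [a]; since the shadow of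
    [f] contains the shadows of its slices, Karamata's inequality for the
    curve at length [n - 1] concludes. Compression enters only at [n = 1] and
    in the degenerate case [s = 1]. *)

(** * Layer sums and threshold functions *)

(* This is [\sum_j 'C(n, j) q ^ (n - j) phi j], the weight of the family
   [w |-> phi (number of s in w)] on the words of [s]^n, for [q = s - 1]. *)
Fixpoint layer_sum (R : realFieldType) (q : R) (n : nat) (phi : nat -> R) : R :=
  if n is n'.+1
  then q * layer_sum q n' phi + layer_sum q n' (fun j => phi j.+1)
  else phi 0%N.

(** The index is one ahead of that of [ball]: the ball with parameters [k], [alpha] belongs to
    [threshold k.+1 alpha]. *)
Definition threshold (R : realFieldType) (k : nat) (alpha : R) (j : nat) : R :=
  if (j < k)%N then 1 else if j == k then alpha else 0.

Section LayerSum.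
Variables (R : realFieldType) (q : R).
Implicit Types (n k : nat) (phi psi : nat -> R).

Lemma eq_layer_sum n phi psi :
  (forall j, (j <= n)%N -> phi j = psi j) -> layer_sum q n phi = layer_sum q n psi.
Proof.
elim: n phi psi => [|n IH] phi psi eq_phi /=; first exact: eq_phi.
by congr (_ * _ + _); apply: IH => j le_jn; apply: eq_phi; rewrite ?ltnS ?(leqW le_jn).
Qed.

Lemma layer_sumS n phi :
  layer_sum q n.+1 phi = q * layer_sum q n phi + layer_sum q n (fun j => phi j.+1).
Proof. by []. Qed.

Lemma layer_sum_lin n a b phi psi :
  layer_sum q n (fun j => a * phi j + b * psi j) =
  a * layer_sum q n phi + b * layer_sum q n psi.
Proof. by elim: n phi psi => [//|n IH] phi psi /=; rewrite !IH; ring. Qed.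

Lemma layer_sum_const n a : layer_sum q n (fun=> a) = (q + 1) ^+ n * a.
Proof. by elim: n => [|n /= ->]; rewrite ?expr0 ?exprS /=; ring. Qed.

(** Termwise this is [(n + 1) 'C(n, j) = (n + 1 - j) 'C(n + 1, j)]. It moves layer sums from length
    [n] to length [n + 1], where they can be compared pointwise. *)
Lemma layer_sum_shift n phi :
  n.+1%:R * q * layer_sum q n phi =
  layer_sum q n.+1 (fun j => (n.+1%:R - j%:R) * phi j).
Proof.
elim: n phi => [|n IH] phi; first by rewrite /=; ring.
rewrite [RHS]layer_sumS; set psi := fun j : nat => (n.+2%:R - j%:R) * phi j.
have ->: layer_sum q n.+1 psi =
   1 * layer_sum q n.+1 (fun j => (n.+1%:R - j%:R) * phi j) + 1 * layer_sum q n.+1 phi.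
  by rewrite -layer_sum_lin; apply: eq_layer_sum => j _; rewrite /psi; ring.
have ->: layer_sum q n.+1 (fun j => (n.+2%:R - j.+1%:R) * phi j.+1) =
   layer_sum q n.+1 (fun j => (n.+1%:R - j%:R) * phi j.+1).
  by apply: eq_layer_sum => j _; ring.
by rewrite -!IH /=; ring.
Qed.

(** A discrete intermediate value argument in [k], then linear interpolation in [alpha]. The
    alternative [k = n] covers [t] above the total weight. *)
Lemma threshold_layer_sum n t : 0 <= t ->
  exists k alpha, [/\ 0 <= alpha <= 1, layer_sum q n (threshold k alpha) <= t
    & layer_sum q n (threshold k alpha) = t \/ k = n].
Proof.
move=> t_ge0; pose N k := layer_sum q n (threshold k 0).
have N_step k alpha : layer_sum q n (threshold k alpha) = N k + alpha * (N k.+1 - N k).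
  transitivity ((1 - alpha) * N k + alpha * N k.+1); last by ring.
  rewrite -layer_sum_lin; apply: eq_layer_sum => j _; rewrite /threshold ltnS.
  by case: ltngtP => _; rewrite ?if_same; ring.
have [tN|Nt] := leP t (N n.+1); last first.
  exists n, 1; split; [lra| |by right].
  by rewrite N_step; lra.
have [k [_ Nk tk]] : exists k, [/\ (k <= n)%N, N k <= t & t <= N k.+1].
  elim: (n) tN => [|i IH] ti.
    exists 0%N; split=> //; apply: le_trans t_ge0.
    by rewrite /N (@eq_layer_sum n _ (fun=> 0)) ?layer_sum_const ?mulr0 // => -[].
  have [/IH[k [? ? ?]]|/ltW] := leP t (N i.+1); last by exists i.+1.
  by exists k; split=> //; apply: leqW.
have [eqN|neqN] := eqVneq (N k.+1 - N k) 0.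
  by exists k, 0; rewrite N_step mul0r addr0; split=> //; [lra|left; lra].
have N_gt0 : 0 < N k.+1 - N k by rewrite lt_def neqN; lra.
exists k, ((t - N k) / (N k.+1 - N k)); rewrite N_step divfK //; split.
- by rewrite divr_ge0 ?ler_pdivrMr //; lra.
- lra.
- by left; lra.
Qed.

Hypothesis q_gt0 : 0 < q.

Lemma le_layer_sum n phi psi :
  (forall j, phi j <= psi j) -> layer_sum q n phi <= layer_sum q n psi.
Proof.
elim: n phi psi => [|n IH] phi psi le_phi //=.
by apply: lerD; rewrite ?ler_pM2l //; apply: IH.
Qed.

Lemma layer_sum_ge0 n phi : (forall j, 0 <= phi j) -> 0 <= layer_sum q n phi.
Proof.
by move=> phi_ge0; apply: le_trans (le_layer_sum n phi_ge0); rewrite layer_sum_const mulr0.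
Qed.

Lemma layer_sum_succ_ge n phi : (forall j, 0 <= phi j) ->
  q * layer_sum q n phi <= layer_sum q n.+1 phi.
Proof. by move=> phi_ge0; rewrite layer_sumS lerDl; apply: layer_sum_ge0 => j. Qed.

(* Neyman-Pearson: [layer_sum q m phi - sigma * layer_sum q m.+1 phi] is a
   positive multiple of the layer sum of [(k - j) * phi j]. *)
Lemma threshold_support m k alpha sigma phi : (forall j, 0 <= phi j <= 1) ->
  m.+1%:R * q * sigma = m.+1%:R - k%:R ->
  layer_sum q m phi - sigma * layer_sum q m.+1 phi <=
  layer_sum q m (threshold k alpha) - sigma * layer_sum q m.+1 (threshold k alpha).
Proof.
set z := m.+1%:R * q => phi01 z_sigma.
have z_gt0 : 0 < z by rewrite mulr_gt0 ?ltr0n.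
have key psi : z * (layer_sum q m psi - sigma * layer_sum q m.+1 psi) =
    layer_sum q m.+1 (fun j => (k%:R - j%:R) * psi j).
  rewrite mulrBr layer_sum_shift mulrA z_sigma.
  rewrite -[X in X - _]mul1r -mulNr -layer_sum_lin.
  by apply: eq_layer_sum => j _; ring.
rewrite -(ler_pM2l z_gt0) !key; apply: le_layer_sum => j.
have /andP[phi_ge0 phi_le1] := phi01 j; rewrite /threshold; case: ltngtP => jk.
- by rewrite ler_wpM2l // subr_ge0 ler_nat ltnW.
- by rewrite mulr0 mulr_le0_ge0 // subr_le0 ler_nat ltnW.
- by rewrite jk subrr !mul0r.
Qed.

End LayerSum.

(** * A Karamata inequality *)

(** If more than [p] entries exceed [c], these suffice. Otherwise cutting the entries down to [c]
    loses at most [a - c] for each of at most [p] of them. *)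
Lemma sum_min_ge (R : realFieldType) (I : finType) (t : I -> R) (p : nat) (a c : R) :
  0 <= c <= a -> (forall i, 0 <= t i <= a) -> p%:R * a + c <= \sum_i t i ->
  p.+1%:R * c <= \sum_i Num.min (t i) c.
Proof.
move=> /andP[c_ge0 le_ca] t_bd sum_t; pose P := [pred i | c < t i].
have sumC b : \sum_(i | P i) b = #|P|%:R * b :> R by rewrite sumr_const mulr_natl.
have minP : \sum_(i | P i) Num.min (t i) c = #|P|%:R * c.
  by rewrite -sumC; apply: eq_bigr => i /= /ltW; apply: min_idPr.
have minNP : \sum_(i | ~~ P i) Num.min (t i) c = \sum_(i | ~~ P i) t i.
  by apply: eq_bigr => i /=; rewrite -leNgt; apply: min_idPl.
have tP : \sum_(i | P i) t i <= #|P|%:R * a.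
  by rewrite -sumC; apply: ler_sum => i _; case/andP: (t_bd i).
have tNP : 0 <= \sum_(i | ~~ P i) t i by apply: sumr_ge0 => i _; case/andP: (t_bd i).
rewrite (bigID P) /= minP minNP; rewrite (bigID P) /= in sum_t.
have [lt_pP|le_Pp] := ltnP p #|P|.
  apply: le_trans (_ : #|P|%:R * c <= _); last by rewrite lerDl.
  by rewrite ler_wpM2r // ler_nat.
have : (p%:R - #|P|%:R) * c <= (p%:R - #|P|%:R) * a.
  by rewrite ler_wpM2l // subr_ge0 ler_nat.
by rewrite -[p.+1]addn1 natrD; lra.
Qed.

(* The instance of Karamata's inequality for the majorizing vector consisting
   of [p] entries [a], one entry [c], and zeros. The lines
   [t |-> sigma i * t + beta i] all lie above [(0, 0)], [(c, c')], [(a, a')]. *)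
Lemma sum_lines_ge (R : realFieldType) (I : finType) (t D sigma beta : I -> R)
    (p : nat) (a c a' c' tau gamma : R) :
  0 <= c <= a -> 0 <= c' <= a' -> (c = 0 -> c' <= 0) -> (a <= c -> a' <= c') ->
  0 <= gamma -> tau * c + gamma = c' -> a' <= tau * a + gamma ->
  (forall i, 0 <= t i <= a) -> p%:R * a + c <= \sum_i t i ->
  (forall i, [/\ sigma i * t i + beta i <= D i, 0 <= beta i,
      c' <= sigma i * c + beta i & a' <= sigma i * a + beta i]) ->
  p%:R * a' + c' <= \sum_i D i.
Proof.
move=> /[dup] ca /andP[c_ge0 le_ca] /andP[c'_ge0 le_c'a'] c0 ac gamma_ge0 tau_c tau_a.
move=> t_bd sum_t lines.
(* The slopes of the broken line through [(0, 0)], [(c, c')], [(a, a')]. If [c = 0], the first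
   segment is a point; if [a = c], division by zero gives [s2 = 0]. *)
pose s2 := (a' - c') / (a - c); pose s1 := if c == 0 then s2 else c' / c.
have s2E : s2 * (a - c) = a' - c'.
  rewrite /s2; have [eq_ac|/divfK->//] := eqVneq (a - c) 0.
  by rewrite eq_ac mulr0; have := ac; lra.
have s2_ge0 : 0 <= s2 by rewrite divr_ge0 ?subr_ge0.
have s1E : s1 * c = c'.
  rewrite /s1; case: eqVneq => [c_eq0|/divfK//].
  by move: tau_c (c0 c_eq0); rewrite c_eq0 !mulr0; lra.
(* Concavity: the line of slope [tau] through [(c, c')] has intercept [gamma >= 0], so [tau <= s1],
   and it passes above [(a, a')], so [s2 <= tau]. *)
have le_s21 : s2 <= s1.
  rewrite /s1; case: eqVneq => // c_neq0; have c_gt0 : 0 < c by rewrite lt_def c_neq0.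
  have [ltca|leac] := ltP c a; last first.
    have -> : s2 = 0 by rewrite /s2 (_ : a' - c' = 0) ?mul0r //; have := ac leac; lra.
    exact: divr_ge0.
  apply: (@le_trans _ _ tau); last by rewrite ler_pdivlMr //; lra.
  by rewrite ler_pdivrMr ?subr_gt0 //; lra.
(* The left side is the broken line at [t i]; line [i] is above its three vertices, hence above
   it. *)
have D_ge i : s2 * t i + (s1 - s2) * Num.min (t i) c <= D i.
  have [le_D beta_ge0 line_c line_a] := lines i; apply: le_trans le_D.
  have /andP[t_ge0 t_le] := t_bd i.
  have [tc|ct] := leP (t i) c; last first.
    have lt_ca : 0 < a - c by lra.
    rewrite -(ler_pM2l lt_ca).
    have : (a - t i) * c' <= (a - t i) * (sigma i * c + beta i) by rewrite ler_wpM2l; lra.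
    have : (t i - c) * a' <= (t i - c) * (sigma i * a + beta i) by rewrite ler_wpM2l; lra.
    have -> : (a - c) * (s2 * t i + (s1 - s2) * c) = (s2 * (a - c)) * (t i - c) + s1 * c * (a - c).
      by ring.
    by rewrite s2E s1E; lra.
  have [c_eq0|c_neq0] := eqVneq c 0.
    have -> : t i = 0 by lra.
    by rewrite !mulr0; lra.
  have c_gt0 : 0 < c by rewrite lt_def c_neq0.
  rewrite -(ler_pM2l c_gt0).
  have : t i * c' <= t i * (sigma i * c + beta i) by rewrite ler_wpM2l.
  have : t i * beta i <= c * beta i by rewrite ler_wpM2r.
  have -> : c * (s2 * t i + (s1 - s2) * t i) = t i * (s1 * c) by ring.
  by rewrite s1E; lra.
apply: le_trans (ler_sum _ (fun i _ => D_ge i)).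
rewrite big_split -!mulr_sumr /=.
have := sum_min_ge ca t_bd sum_t.
rewrite -subr_ge0 in le_s21 => /(ler_wpM2l le_s21).
move: (ler_wpM2l s2_ge0 sum_t).
have <- : p%:R * (s2 * (a - c) + s1 * c) + s1 * c = p%:R * a' + c' by rewrite s2E s1E; ring.
by rewrite -[p.+1]addn1 natrD; lra.
Qed.

(** * Words, slices and compression *)

Section Words.
Variables (R : realType) (r : nat).

Lemma sum_tuple_cons n (F : n.+1.-tuple 'I_r -> R) :
  \sum_w F w = \sum_y \sum_(x : n.-tuple 'I_r) F [tuple of y :: x].
Proof.
rewrite pair_big /= (reindex (fun p : 'I_r * n.-tuple 'I_r => [tuple of p.1 :: p.2])) //=.
exists (fun w => (thead w, [tuple of behead w])) => [[y x] _|w _] /=.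
  by congr (_, _); apply: val_inj.
by rewrite [RHS]tuple_eta.
Qed.

Lemma sum_tuple0 (F : 0.-tuple 'I_r -> R) : \sum_w F w = F [tuple].
Proof. by apply: big_pred1 => w; apply/esym/eqP/tuple0. Qed.

Lemma sum_layers n q (phi : nat -> R) : (q < r)%N ->
  \sum_(w : n.-tuple 'I_r)
    (if all (fun a => sym a <= q.+1)%N w
     then phi (count (fun a => sym a == q.+1) w) else 0) =
  layer_sum q%:R n phi.
Proof.
move=> lt_qr; elim: n phi => [|n IH] phi; first by rewrite sum_tuple0.
rewrite sum_tuple_cons layer_sumS; set A := layer_sum _ _ _; set B := layer_sum _ _ _.
(* By first letter: the [q] symbols below [s] keep the count, [s] raises it by one, larger ones
   contribute nothing. *)
transitivity (\sum_(y < r) ((if (y < q)%N then A else 0) + (if y == Ordinal lt_qr then B else 0))).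
  apply: eq_bigr => y _ /=.
  rewrite /sym -val_eqE /= eqSS ltnS.
  by case: ltngtP => _ /=; rewrite ?add0r ?addr0 /A /B -?IH // big1.
rewrite big_split -!big_mkcond /= big_pred1_eq.
by rewrite -(big_ord_widen r (fun=> A) (ltnW lt_qr)) sumr_const card_ord mulr_natl.
Qed.

Lemma le_shadow_ins m (f : m.+1.-tuple 'I_r -> R) i y x : f (ins i y x) <= shadow f x.
Proof.
apply: le_trans (le_bigmax _ _ i).
exact: (le_bigmax _ (fun y => f (ins i y x))).
Qed.

Lemma shadow_le m (f : m.+1.-tuple 'I_r -> R) x b :
  0 <= b -> (forall i y, f (ins i y x) <= b) -> shadow f x <= b.
Proof. by move=> b_ge0 f_le; do 2!apply: bigmax_le => // ? _. Qed.

Lemma shadow_ge0 m (f : m.+1.-tuple 'I_r -> R) x : 0 <= shadow f x.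
Proof. exact: bigmax_ge_id. Qed.

Definition slice n (f : n.+1.-tuple 'I_r -> R) (y : 'I_r) : n.-tuple 'I_r -> R :=
  fun x => f [tuple of y :: x].

Lemma weight_slices n (f : n.+1.-tuple 'I_r -> R) :
  weight f = \sum_y weight (slice f y).
Proof. exact: sum_tuple_cons. Qed.

Lemma weight_slice_le_shadow m (f : m.+1.-tuple 'I_r -> R) y :
  weight (slice f y) <= weight (shadow f).
Proof.
apply: ler_sum => x _.
have -> : slice f y x = f (ins ord0 y x).
  by congr f; apply: val_inj; rewrite /= take0 drop0.
exact: le_shadow_ins.
Qed.

Lemma weight_shadow_slices m (f : m.+2.-tuple 'I_r -> R) :
  \sum_y weight (shadow (slice f y)) <= weight (shadow f).
Proof.
rewrite (weight_slices (shadow f)); apply: ler_sum => y _; apply: ler_sum => x _.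
apply: shadow_le => [|i z]; first exact: shadow_ge0.
have -> : slice f y (ins i z x) = f (ins (lift ord0 i) z [tuple of y :: x]).
  by congr f; apply: val_inj.
exact: le_shadow_ins.
Qed.

Lemma replace_cons n (y z : 'I_r) (x : n.-tuple 'I_r) i :
  replace [tuple of y :: x] (lift ord0 i) z = [tuple of y :: replace x i z].
Proof.
apply: eq_from_tnth => j; rewrite tnth_mktuple.
by case: (unliftP ord0 j) => [k|] ->; rewrite !(tnthS, tnth0) ?tnth_mktuple // (inj_eq lift_inj).
Qed.

Lemma replace_cons0 n (y z : 'I_r) (x : n.-tuple 'I_r) :
  replace [tuple of y :: x] ord0 z = [tuple of z :: x].
Proof.
apply: eq_from_tnth => j; rewrite tnth_mktuple.
by case: (unliftP ord0 j) => [k|] ->; rewrite !(tnthS, tnth0).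
Qed.

Lemma frac_family_slice n (f : n.+1.-tuple 'I_r -> R) y :
  frac_family f -> frac_family (slice f y).
Proof. by move=> f01 x; apply: f01. Qed.

Lemma compressed_slice l n (f : n.+1.-tuple 'I_r -> R) y :
  compressed l f -> compressed l (slice f y).
Proof.
move=> f_comp x i z lt_z le_l fx; rewrite /slice -replace_cons.
by apply: f_comp; rewrite ?tnthS.
Qed.

Lemma compressed_head l n (f : n.+1.-tuple 'I_r -> R) y z (x : n.-tuple 'I_r) :
  compressed l f -> (sym z < sym y)%N -> (l <= sym y)%N ->
  0 < f [tuple of y :: x] -> f [tuple of z :: x] = 1.
Proof.
by move=> f_comp lt_zy le_l fy; rewrite -(replace_cons0 y); apply: f_comp; rewrite ?tnth0.
Qed.

Lemma weight_ge0 n (f : n.-tuple 'I_r -> R) : frac_family f -> 0 <= weight f.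
Proof. by move=> f01; apply: sumr_ge0 => w _; case/andP: (f01 w). Qed.

Lemma weight_ge n (f : n.-tuple 'I_r -> R) w : frac_family f -> f w <= weight f.
Proof.
move=> f01; rewrite /weight (bigD1 w) //= lerDl.
by apply: sumr_ge0 => w' _; case/andP: (f01 w').
Qed.

(** If [f] is positive on a symbol above [q], compression gives value 1 on the least symbol.
    Otherwise at most [q] symbols carry weight, each at most that of the shadow. *)
Lemma weight_le_shadow1 q (f : 1.-tuple 'I_r -> R) : (0 < q < r)%N -> frac_family f ->
  compressed q.+1 f -> weight f <= q%:R * weight (shadow f) \/ 1 <= weight (shadow f).
Proof.
move=> /andP[q_gt0 lt_qr] f01 f_comp.
have slice1 y : weight (slice f y) = slice f y [tuple] by exact: sum_tuple0.
have [/existsP[y /andP[le_qy fy_gt0]]|/existsPn f0] :=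
    boolP [exists y : 'I_r, (q <= y)%N && (0 < slice f y [tuple])].
  right; pose z : 'I_r := Ordinal (leq_ltn_trans (leq0n y) (ltn_ord y)).
  have <- : slice f z [tuple] = 1.
    by apply: (compressed_head f_comp _ _ fy_gt0); rewrite /sym !ltnS // (leq_trans q_gt0).
  by rewrite -slice1 weight_slice_le_shadow.
left.
rewrite weight_slices (bigID (fun y : 'I_r => (y < q)%N)) /= [X in _ + X]big1 ?addr0; last first.
  move=> y; rewrite -leqNgt slice1 => le_qy.
  have /andP[fy_ge0 _] := frac_family_slice y f01 [tuple].
  by apply: le_anti; rewrite fy_ge0 andbT leNgt; have := f0 y; rewrite le_qy.
apply: le_trans (ler_sum _ (fun y _ => weight_slice_le_shadow f y)) _.
by rewrite -(big_ord_widen r (fun=> weight (shadow f)) (ltnW lt_qr)) sumr_const card_ord mulr_natl.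
Qed.

End Words.

(** * The induction on word length *)

Lemma threshold01 (R : realFieldType) k (alpha : R) j :
  0 <= alpha <= 1 -> 0 <= threshold k alpha j <= 1.
Proof. by move=> alpha01; rewrite /threshold; case: ltngtP => // _; lra. Qed.

Lemma le_threshold_succ (R : realFieldType) k (alpha : R) j :
  0 <= alpha <= 1 -> threshold k alpha j.+1 <= threshold k alpha j.
Proof.
move=> alpha01; have /andP[? ?] := threshold01 k j alpha01.
rewrite {1}/threshold; case: ltngtP => [lt_jk|_|eq_jk] //.
  by rewrite /threshold ltnW.
by rewrite /threshold -eq_jk ltnSn; lra.
Qed.

Section Induction.
Variables (R : realType) (r q : nat).
Hypothesis q_bd : (0 < q < r)%N.

Let Q : R := q%:R.

Let Q_gt0 : 0 < Q. Proof. by rewrite ltr0n; case/andP: q_bd. Qed.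

Lemma line_below_shadow m (f : m.+1.-tuple 'I_r -> R) : frac_family f ->
  (forall k alpha, 0 <= alpha <= 1 ->
     layer_sum Q m.+1 (threshold k alpha) <= weight f ->
     layer_sum Q m (threshold k alpha) <= weight (shadow f)) ->
  exists sigma beta, sigma * weight f + beta <= weight (shadow f) /\
    forall phi, (forall j, 0 <= phi j <= 1) ->
      layer_sum Q m phi <= sigma * layer_sum Q m.+1 phi + beta.
Proof.
(* The line supports the curve at the ball of weight [weight f]; if [f] is
   heavier than [s]^n then [k = m.+1] and the line is horizontal. *)
move=> f01 shadow_ge.
have [k [alpha [alpha01 le_t t_eq]]] := threshold_layer_sum Q m.+1 (weight_ge0 f01).
pose z : R := m.+1%:R * Q; pose sigma := (m.+1%:R - k%:R) / z.
have z_neq0 : z != 0 by rewrite gt_eqF // mulr_gt0 // ltr0n.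
exists sigma, (layer_sum Q m (threshold k alpha) - sigma * layer_sum Q m.+1 (threshold k alpha)).
split=> [|phi phi01].
  have : sigma * (weight f - layer_sum Q m.+1 (threshold k alpha)) = 0.
    case: t_eq => [->|k_eq]; first by rewrite subrr mulr0.
    by rewrite /sigma k_eq subrr !mul0r.
  by have := shadow_ge k alpha alpha01 le_t; lra.
have z_sigma : z * sigma = m.+1%:R - k%:R by rewrite mulrC divfK.
by have := threshold_support Q_gt0 alpha phi01 z_sigma; lra.
Qed.

(** Lying above the concave curve is expressed by a line between the point of [f] and the curve;
    this is the form in which [sum_lines_ge] takes the induction hypothesis for the slices. *)
Lemma shadow_above_line m (f : m.+1.-tuple 'I_r -> R) :
  frac_family f -> compressed q.+1 f ->
  exists sigma beta, sigma * weight f + beta <= weight (shadow f) /\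
    forall phi, (forall j, 0 <= phi j <= 1) ->
      layer_sum Q m phi <= sigma * layer_sum Q m.+1 phi + beta.
Proof.
elim: m f => [|m IH] f f01 f_comp; apply: line_below_shadow => // k alpha alpha01 le_t.
  have th01 j := threshold01 k j alpha01.
  move: le_t; rewrite /=; have := th01 0%N; have := th01 1%N.
  have [f_le|] := weight_le_shadow1 q_bd f01 f_comp; last by lra.
  by move=> ? ? ?; rewrite -(ler_pM2l Q_gt0); rewrite -/Q in f_le; lra.
set phi := threshold k alpha; pose phi' j := phi j.+1.
have phi01 j : 0 <= phi j <= 1 by apply: threshold01.
have phi'01 j : 0 <= phi' j <= 1 by apply: phi01.
have le_phi' j : phi' j <= phi j by apply: le_threshold_succ.
pose a := layer_sum Q m.+1 phi; pose c := layer_sum Q m.+1 phi'.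
have [/existsP[y ay]|/existsPn t_lt] := boolP [exists y, a <= weight (slice f y)].
  by apply: le_trans ay _; apply: weight_slice_le_shadow.
apply: le_trans (weight_shadow_slices f).
pose a' := layer_sum Q m phi; pose c' := layer_sum Q m phi'.
have lines y : exists line : R * R,
    line.1 * weight (slice f y) + line.2 <= weight (shadow (slice f y)) /\
    forall psi, (forall j, 0 <= psi j <= 1) ->
      layer_sum Q m psi <= line.1 * layer_sum Q m.+1 psi + line.2.
  have [sigma [beta ?]] := IH _ (frac_family_slice y f01) (compressed_slice f_comp).
  by exists (sigma, beta).
have {lines} [line lineP] := fin_all_exists lines.
(* The supporting line at [phi'], again a threshold function. Testing it on [0] gives [gamma >= 0],
   and on [phi] the bound at [a]. *)
have [tau [gamma [gamma_ge0 tau_c tau_a]]] : exists tau gamma,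
    [/\ 0 <= gamma, tau * c + gamma = c' & a' <= tau * a + gamma].
  have [k' [alpha' phi'E]] : exists k' alpha', forall j, phi' j = threshold k' alpha' j.
    rewrite /phi' /phi; case: (k) => [|k']; last by exists k', alpha.
    by exists 0%N, 0 => j; rewrite /threshold /= if_same.
  pose tau := (m.+1%:R - k'%:R) / (m.+1%:R * Q).
  have support psi : (forall j, 0 <= psi j <= 1) ->
      layer_sum Q m psi - tau * layer_sum Q m.+1 psi <= c' - tau * c.
    move=> psi01; rewrite /c' /c !(eq_layer_sum _ (fun j _ => phi'E j)).
    apply: (threshold_support Q_gt0) => //.
    by rewrite mulrC divfK // gt_eqF // mulr_gt0 // ltr0n.
  exists tau, (c' - tau * c); split; [|by lra|].
    have : forall j : nat, 0 <= (0 : R) <= 1 by move=> _; lra.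
    by move/support; rewrite !layer_sum_const !mulr0 subrr.
  by have := support _ phi01; rewrite -/a -/a'; lra.
have -> : layer_sum Q m.+1 phi = q%:R * a' + c' by [].
have phi'_ge0 j : 0 <= phi' j by case/andP: (phi'01 j).
have c'_ge0 : 0 <= c' by apply: layer_sum_ge0.
have diffE n : layer_sum Q n (fun j => 1 * phi j + (-1) * phi' j) =
    layer_sum Q n phi - layer_sum Q n phi' by rewrite layer_sum_lin; ring.
apply: (sum_lines_ge (t := fun y => weight (slice f y)) (sigma := fun y => (line y).1)
  (beta := fun y => (line y).2) (a := a) (c := c) _ _ _ _ gamma_ge0 tau_c tau_a).
- by rewrite layer_sum_ge0 //= le_layer_sum.
- by rewrite c'_ge0 /= le_layer_sum.
(* The two degenerate cases follow from [q c' <= c] and from [q (a' - c') <= a - c], the latter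
   because [phi - phi' >= 0]. *)
- by move=> c_eq0; rewrite -(pmulr_rle0 _ Q_gt0) -c_eq0 layer_sum_succ_ge.
- move=> le_ac; have := @layer_sum_succ_ge _ _ Q_gt0 m (fun j => 1 * phi j + (-1) * phi' j).
  rewrite !diffE -/a -/c -/a' -/c' => le_succ.
  rewrite -subr_le0 -(pmulr_rle0 _ Q_gt0); apply: le_trans (le_succ _) _; last by lra.
  by move=> j; have := le_phi' j; lra.
- move=> y /=; rewrite weight_ge0 /=; last exact: frac_family_slice.
  by have := t_lt y; rewrite -ltNge => /ltW.
- by rewrite -weight_slices.
move=> y; have [le_D above] := lineP y; split; first exact: le_D.
(* The zero function gives the sign of the intercept. *)
- have : forall j : nat, 0 <= (0 : R) <= 1 by move=> _; lra.
  by move/above; rewrite !layer_sum_const !mulr0 add0r.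
- exact: above.
- exact: above.
Qed.

End Induction.

(** * Shadows of balls *)

Section Ball.
Variables (R : realType) (r : nat).
Implicit Types (k q : nat) (alpha : R).

Lemma weight_ball n q k alpha : (q < r)%N ->
  weight (@ball R r n q.+1 k alpha) = layer_sum q%:R n (threshold k.+1 alpha).
Proof. by move=> lt_qr; rewrite -(sum_layers n _ lt_qr); apply: eq_bigr => w _. Qed.

(** Only letter counts matter, so the insertion may be made at the front. The function [phi] is left
    free because the best letter to insert is below [s] if [q > 0], but [s] itself if [q = 0]. *)
Lemma shadow_ball_le m q k alpha (x : m.-tuple 'I_r) (phi : nat -> R) :
  (forall j, 0 <= phi j) ->
  (forall y : 'I_r, (y <= q)%N -> forall j,
     threshold k.+1 alpha ((val y == q) + j)%N <= phi j) ->
  shadow (@ball R r m.+1 q.+1 k alpha) x <=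
    if all (fun a => sym a <= q.+1)%N x
    then phi (count (fun a => sym a == q.+1) x) else 0.
Proof.
move=> phi_ge0 le_phi; apply: shadow_le => [|i y]; first by case: ifP.
have perm_ins : perm_eq (ins i y x) (y :: x).
  by rewrite /= -cat1s perm_catCA /= cat_take_drop.
rewrite /ball (perm_all _ perm_ins) (permP perm_ins) /=.
case: (leqP (sym y) q.+1) => //= le_yq; case: ifP => // _.
by apply: le_trans (le_phi y le_yq _); rewrite /threshold.
Qed.

End Ball.

(** * The case [s = 1] and the conclusion *)

(** Lower the tail to the least symbol by the induction hypothesis for the slice, then lower the
    first letter. *)
Lemma compressed1_support (R : realType) r n (f : n.-tuple 'I_r.+1 -> R) w :
  compressed 1 f -> 0 < f w ->
  w = [tuple of nseq n ord0] \/ f [tuple of nseq n ord0] = 1.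
Proof.
elim: n f w => [|n IH] f w f_comp fw_gt0; first by left; rewrite [w]tuple0 [RHS]tuple0.
have eq_w : w = [tuple of thead w :: behead_tuple w] by rewrite [LHS]tuple_eta.
have eq0 : [tuple of nseq n.+1 ord0] = [tuple of ord0 :: nseq n ord0] :> n.+1.-tuple 'I_r.+1.
  exact: val_inj.
rewrite eq0 {1}eq_w; move: fw_gt0; rewrite eq_w.
move: (thead w) (behead_tuple w) => y x fyx_gt0 {w eq_w}.
have fy0_gt0 : x = [tuple of nseq n ord0] \/ f [tuple of y :: nseq n ord0] = 1.
  exact: IH (compressed_slice f_comp) fyx_gt0.
have [y0|y_neq0] := eqVneq y ord0.
  by move: fy0_gt0; rewrite y0 => -[->|]; [left; apply: val_inj | right].
right; apply: (compressed_head (y := y) (x := [tuple of nseq n ord0]) f_comp) => //.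
  by rewrite ltnS lt0n.
by case: fy0_gt0 fyx_gt0 => [->|->].
Qed.

(* n = m.+1 (so n >= 1), A = [r] represented by 'I_r *)
Theorem theorem4 (R : realType) (r m s k : nat) (alpha : R)
    (f : m.+1.-tuple 'I_r -> R) :
  (1 <= r)%N -> (1 <= s <= r)%N ->
  frac_family f -> compressed s f ->
  weight f <= s%:R ^+ m.+1 ->
  0 <= alpha <= 1 ->
  weight (@ball R r m.+1 s k alpha) = weight f ->
  weight (shadow f) >= weight (shadow (@ball R r m.+1 s k alpha)).
Proof.
move=> r_gt0 /andP[s_gt0 le_sr] f01 f_comp le_fs alpha01.
case: s s_gt0 le_sr f_comp le_fs => [//|q] _ lt_qr f_comp le_fs eq_w.
have th_ge0 j : 0 <= threshold k.+1 alpha j by case/andP: (threshold01 k.+1 j alpha01).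
have [q0|q_gt0] := posnP q; last first.
  apply: (@le_trans _ _ (layer_sum q%:R m (threshold k.+1 alpha))).
    rewrite -(sum_layers m _ lt_qr); apply: ler_sum => x _.
    (* Inserting a letter below [s] keeps the count; inserting [s] can only lower the value. *)
    apply: shadow_ball_le => // y _ j; case: eqP => _ //.
    exact: le_threshold_succ.
  have q_bd : (0 < q < r)%N by rewrite q_gt0.
  have [sigma [beta [le_D above]]] := shadow_above_line q_bd f01 f_comp.
  apply: le_trans (above _ (fun j => threshold01 k.+1 j alpha01)) _.
  by rewrite -(@weight_ball R r _ _ _ _ lt_qr) eq_w.
(* For [s = 1] the inserted letter is [s], and with [q = 0] the layer sum at length [m + 1] is that
   of the shifted function at length [m]; so the shadow of the ball weighs at most [weight f]. *)
subst q; apply: (@le_trans _ _ (weight f)).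
  rewrite -eq_w (@weight_ball R r _ _ _ _ lt_qr) /= mul0r add0r.
  rewrite -(sum_layers m _ lt_qr); apply: ler_sum => x _.
  apply: (@shadow_ball_le R r _ _ _ _ x (fun j => threshold k.+1 alpha j.+1)) => [j|y].
    exact: th_ge0.
  by rewrite leqn0 => ->.
case: r r_gt0 f f01 f_comp le_fs {lt_qr eq_w} => [//|r] _ f f01 f_comp; rewrite expr1n => le_f1.
(* A second word in the support would force value 1 on the word of least symbols, and the weight
   would exceed 1. *)
have weight_eq : weight f = f [tuple of nseq m.+1 ord0].
  rewrite /weight (bigD1 [tuple of nseq m.+1 ord0]) //= big1 ?addr0 // => w w_neq0.
  have /andP[fw_ge0 _] := f01 w; apply: le_anti; rewrite fw_ge0 andbT leNgt; apply/negP => fw_gt0.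
  have [eq_w|f0] := compressed1_support f_comp fw_gt0; first by rewrite eq_w eqxx in w_neq0.
  move: le_f1; rewrite /weight (bigD1 [tuple of nseq m.+1 ord0]) //= f0 (bigD1 w) //=.
  have : 0 <= \sum_(i | (i != [tuple of nseq m.+1 ord0]) && (i != w)) f i.
    by apply: sumr_ge0 => v _; case/andP: (f01 v).
  lra.
rewrite weight_eq; apply: le_trans (weight_slice_le_shadow f ord0).
have -> : f [tuple of nseq m.+1 ord0] = slice f ord0 [tuple of nseq m ord0].
  by congr f; apply: val_inj.
by apply: weight_ge; apply: frac_family_slice.
Qed.
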